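(* Let $E,J,R\in\mathbb{C}^{n,n}$ and $B\in\mathbb{C}^{n,m}$ with $E=E^H\ge 0$, $R=R^H\ge 0$, $J=-J^H$ and $B$ of full column rank (the coefficients of a port-Hamiltonian descriptor system $E\dot x=(J-R)x+Bu$, $y=B^Hx$). Then there exist matrices $F_S=-F_S^H\in\mathbb{C}^{m,m}$ and $F_H=F_H^H\in\mathbb{C}^{m,m}$ such that the pair $(E,\;J+BF_SB^H-(R+BF_HB^H))$ is regular and of index at most one, and $R+BF_HB^H\ge 0$, if and only if $$\operatorname{rank}\begin{bmatrix}E & (J-R)\,\mathcal{S}_\infty(E) & B\end{bmatrix}=n.$$
   Context: $\mathbb{C}^{p,q}$ denotes the complex $p\times q$ matrices. For a Hermitian matrix $M$, $M\ge 0$ ($M>0$) means positive semidefinite (positive definite). A pair $(E,A)$ of square matrices (identified with the pencil $\lambda E-A$) is regular if $\det(\lambda_0E-A)\ne 0$ for some $\lambda_0\in\mathbb{C}$. The index of a regular pair is the size of the largest Jordan block associated with the eigenvalue $\infty$ in its Kronecker (Weierstrass) canonical form, and is $0$ if $E$ is invertible. $\mathcal{S}_\infty(M)$ denotes a full column rank matrix whose columns span the right nullspace of $M$ (a matrix with no columns if the nullspace is trivial). *)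

(* Defs.v *)
From mathcomp Require Import all_boot all_order all_algebra.
From mathcomp Require Import reals complex.

Set Implicit Arguments.
Unset Strict Implicit.
Unset Printing Implicit Defensive.

Import Order.TTheory GRing.Theory Num.Theory.
Local Open Scope ring_scope.
Local Open Scope sesquilinear_scope.

(* [0 <= z] in a numClosedFieldType says that z is real and nonnegative. *)
Definition psdmx (C : numClosedFieldType) (n : nat) (M : 'M[C]_n) : Prop :=
  M = M^t* /\ forall x : 'cV[C]_n, 0 <= (x^t* *m M *m x) 0 0.

Definition nullspace_basis (F : fieldType) (p q k : nat)
    (M : 'M[F]_(p, q)) (S : 'M[F]_(q, k)) : Prop :=
  \rank S = k /\
  forall x : 'cV[F]_q, M *m x = 0 <-> exists y : 'cV[F]_k, x = S *m y.

Definition regular_pair (F : fieldType) (n : nat) (E A : 'M[F]_n) : Prop :=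
  exists z : F, \det (z *: E - A) != 0.

Definition jordan_block (F : fieldType) (a : F) (k : nat) : 'M[F]_k :=
  \matrix_(i, j) (a *+ (i == j) + (i.+1 == j :> nat)%:R).

(* The canonical blocks of the pencil lambda E - A are indexed by eigenvalues
   in the field extended by infinity: [Some a] is the finite eigenvalue a, with
   block lambda 1 - J(a), and [None] is infinity, with block lambda J(0) - 1. *)
Definition canonical_blockE (F : fieldType) (ev : option F) (k : nat) : 'M[F]_k :=
  if ev is Some _ then 1%:M else jordan_block 0 k.

Definition canonical_blockA (F : fieldType) (ev : option F) (k : nat) : 'M[F]_k :=
  if ev is Some a then jordan_block a k else 1%:M.

Definition weierstrass_form (F : fieldType) (n : nat) (E A : 'M[F]_n)
    (k : nat) (ev : 'I_k -> option F) (sz : 'I_k -> nat) : Prop :=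
  (forall i, 0 < sz i)%N /\
  exists (szn : (\sum_i sz i)%N = n) (P Q : 'M[F]_n),
    [/\ P \in unitmx, Q \in unitmx,
        P *m E *m Q =
          castmx (szn, szn) (\mxdiag_i canonical_blockE (ev i) (sz i))
      & P *m A *m Q =
          castmx (szn, szn) (\mxdiag_i canonical_blockA (ev i) (sz i))].

(* The maximum over an empty family is 0: this is the case of invertible E. *)
Definition pair_index (F : fieldType) (n : nat) (E A : 'M[F]_n) (nu : nat) : Prop :=
  exists (k : nat) (ev : 'I_k -> option F) (sz : 'I_k -> nat),
    weierstrass_form E A ev sz /\ nu = (\max_(i | ev i == None) sz i)%N.

(* Main.v *)
(* Necessity: at index at most one the Weierstrass form shows that [E AS] has full
   row rank, and a left null vector of [E (J-R)S B] annihilates [E AS] for every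
   feedback. Sufficiency: FS = 0 and FH = 1 work. If x = S w and
   S^H (J - R - B B^H) x = 0, then dissipativity forces R x = 0 and B^H x = 0, so
   that x^H annihilates [E (J-R)S B] and x vanishes. Hence S^H A S is invertible
   for A = J - R - B B^H, which splits off the infinite part of the pencil as
   (0, 1); the remaining pair has an invertible E-part and reduces to the Jordan
   form of a matrix. *)
Require Import Defs.
From mathcomp Require Import all_boot all_order all_algebra.
From mathcomp Require Import reals complex zify ring.
Import Order.TTheory GRing.Theory Num.Theory.
Local Open Scope ring_scope.
Local Open Scope sesquilinear_scope.

Set Implicit Arguments.
Unset Strict Implicit.
Unset Printing Implicit Defensive.

(** * Jordan and Weierstrass forms *)

Lemma col_mulmx (F : fieldType) (m n p : nat) (A : 'M[F]_(m, n))
  (B : 'M[F]_(n, p)) j : col j (A *m B) = A *m col j B.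
Proof. by rewrite !colE mulmxA. Qed.

Lemma unitmx_colker (F : fieldType) (n : nat) (M : 'M[F]_n) :
  (forall x : 'cV[F]_n, M *m x = 0 -> x = 0) -> M \in unitmx.
Proof.
move=> kerM; rewrite -row_full_unit -cokermx_eq0; apply/eqP.
apply/matrixP => i j; have := kerM (col j (cokermx M)).
by rewrite -col_mulmx mulmx_coker col0 => /(_ erefl) /matrixP/(_ i 0); rewrite !mxE.
Qed.

Lemma jordan_blockE (F : fieldType) (a : F) (k : nat) :
  jordan_block a k = a%:M + jordan_block 0 k.
Proof. by apply/matrixP => i j; rewrite !mxE mul0rn add0r. Qed.

(** The block shifts rows up by one. Indexing the rows by [nat] gives a name, [w k], to the row
    shifted in at the bottom, which has to vanish. *)
Lemma jordan_block0_mul (F : fieldType) (n k : nat) (w : nat -> 'rV[F]_n) :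
  w k = 0 ->
  jordan_block 0 k *m (\matrix_(i < k) w i) = \matrix_(i < k) w i.+1.
Proof.
move=> wk0; apply/matrixP => i j; rewrite !mxE.
have [lt_ik | le_ki] := ltnP i.+1 k.
  rewrite (bigD1 (Ordinal lt_ik)) //= big1 => [|l ne_l].
    by rewrite !mxE /= eqxx mul0rn add0r mul1r addr0.
  rewrite !mxE mul0rn add0r; case: eqP => [eq_l|]; last by rewrite mul0r.
  by case/eqP: ne_l; apply: val_inj; rewrite /= eq_l.
have eq_ik : i.+1 = k by apply/eqP; rewrite eqn_leq le_ki ltn_ord.
rewrite eq_ik wk0 mxE big1 // => l _; rewrite !mxE mul0rn add0r.
by rewrite gtn_eqF ?mul0r // eq_ik.
Qed.

(** The block shifts columns to the right, so the chain is listed in reverse order; the first column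
    of the product then has index [k] and vanishes. *)
Lemma mul_jordan_block0 (F : fieldType) (n k : nat) (w : nat -> 'cV[F]_n) :
  w k = 0 ->
  (\matrix_(i < n, j < k) w (k.-1 - j)%N i 0) *m jordan_block 0 k
    = \matrix_(i < n, j < k) w (k - j)%N i 0.
Proof.
move=> wk0; apply/matrixP => i j; rewrite !mxE.
case: j => [[|j] lt_jk].
  rewrite subn0 wk0 mxE big1 // => l _.
  by rewrite !mxE mul0rn add0r mulr0.
rewrite (bigD1 (Ordinal (ltnW lt_jk))) //= big1 => [|l ne_l].
  rewrite !mxE /= eqxx mul0rn add0r mulr1 addr0.
  by case: k lt_jk {wk0} => // k _; rewrite subSS.
rewrite !mxE mul0rn add0r; case: eqP => [/= [eq_l]|]; last by rewrite mulr0.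
by case/eqP: ne_l; apply: val_inj; rewrite /= eq_l.
Qed.

(* With [(X - a)^k] the exact power of [X - a] in the minimal polynomial
   [q (X - a)^k], the matrix [q(A)^2 (A - a)^(k-1)] is nonzero: a nonzero entry
   of it pairs a row of [q(A)] with a column of [q(A)], which generate dual
   Jordan chains of maximal length. *)
Lemma dual_jordan_chains (F : closedFieldType) (n : nat) (A : 'M[F]_n) :
  (0 < n)%N ->
  exists a k (V : 'M[F]_(k, n)) (W : 'M[F]_(n, k)),
    [/\ (0 < k)%N, V *m A = jordan_block a k *m V,
        A *m W = W *m jordan_block a k & V *m W \in unitmx].
Proof.
case: n => // n in A * => _.
have [a pa0] : exists a, root (mxminpoly A) a.
  by apply/closed_rootP; rewrite size_mxminpoly eqSS -lt0n mxminpoly_nonconstant.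
have p_neq0 := monic_neq0 (mxminpoly_monic A).
have [k [q]] := multiplicity_XsubC (mxminpoly A) a.
rewrite p_neq0 /= => qa p_def.
have k_gt0 : (0 < k)%N.
  by case: k p_def => // p_def; rewrite p_def mulr1 (negPf qa) in pa0.
pose N := A - a%:M; pose Q := horner_mx A q.
have N_def : horner_mx A ('X - a%:P) = N by rewrite rmorphB /= horner_mx_X horner_mx_C.
have AN : A = N + a%:M by rewrite subrK.
have commQN i : Q * N ^+ i = N ^+ i * Q.
  by rewrite -N_def -rmorphXn -!rmorphM mulrC.
have QNk : Q * N ^+ k = 0.
  by rewrite -N_def -rmorphXn -rmorphM -p_def /=; apply: mx_root_minpoly.
have : Q * N ^+ k.-1 * Q != 0.
  rewrite -N_def -rmorphXn -!rmorphM /= -dvd_mxminpoly.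
  apply: contra (qa) => /dvdpP[r]; rewrite p_def -{2}(prednK k_gt0) exprS.
  have q_neq0 : q != 0 by apply: contraNneq qa => ->; rewrite root0.
  move=> def_r.
  (* Cancelling the common nonzero factor leaves [q = r * ('X - a%:P)], so that [a] would be a root
     of [q]. *)
  have : q * ('X - a%:P) ^+ k.-1 * q = q * ('X - a%:P) ^+ k.-1 * (r * ('X - a%:P)).
    by rewrite def_r; ring.
  move/mulfI => -> //; first by rewrite rootM root_XsubC eqxx orbT.
  by rewrite mulf_neq0 // expf_neq0 // polyXsubC_eq0.
case/matrix0Pn=> i [j ij_neq0].
pose v i0 := row i Q *m N ^+ i0; pose w j0 := N ^+ j0 *m col j Q.
have vk0 : v k = 0 by rewrite /v -row_mul [_ *m _]QNk row0.
have wk0 : w k = 0 by rewrite /w -col_mulmx -[_ *m _]commQN QNk col0.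
exists a, k, (\matrix_(i0 < k) v i0), (\matrix_(i0 < n.+1, j0 < k) w (k.-1 - j0)%N i0 0).
split=> //.
- rewrite jordan_blockE mulmxDl jordan_block0_mul // {1}AN mulmxDr addrC.
  rewrite scalar_mxC; congr (_ + _).
  by apply/row_matrixP => l; rewrite row_mul !rowK /v -mulmxA exprSr.
- rewrite jordan_blockE mulmxDr mul_jordan_block0 // {1}AN mulmxDl addrC.
  rewrite scalar_mxC; congr (_ + _).
  apply/matrixP => s t; rewrite mxE [RHS]mxE.
  have -> : (k - t = (k.-1 - t).+1)%N.
    by rewrite -subSn ?prednK // -ltnS prednK.
  by rewrite /w exprS -[_ *m col j Q]mulmxA [RHS]mxE; apply: eq_bigr => l _; rewrite mxE.
have vw s t : ((\matrix_(i0 < k) v i0) *m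
   (\matrix_(i0 < n.+1, j0 < k) w (k.-1 - j0)%N i0 0)) s t
     = (Q * N ^+ (s + (k.-1 - t)) * Q) i j.
  transitivity ((v s *m w (k.-1 - t)%N) 0 0).
    by rewrite !mxE; apply: eq_bigr => l _; rewrite !mxE.
  rewrite /v /w -mulmxA [N ^+ s *m _]mulmxA -[N ^+ s *m _]exprD.
  by rewrite -row_mul -!col_mulmx [Q *m _]mulrA !mxE.
(* The product is upper triangular: below the diagonal the exponent of [N] is at least [k], where
   [Q * N ^+ k = 0]; on the diagonal it is [k.-1], which gives the nonzero entry. *)
rewrite unitmxE -det_tr det_trig.
  rewrite unitfE; apply/prodf_neq0 => s _; rewrite mxE vw subnKC //.
  by rewrite -ltnS prednK.
apply/is_trig_mxP => s t lt_st; rewrite mxE vw.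
have -> : (t + (k.-1 - s) = k + (t - s.+1))%N by have := ltn_ord t; lia.
by rewrite exprD mulrA QNk !mul0r mxE.
Qed.

(** [U] is a basis of the left kernel of [W]. Since [V *m W] is invertible, this kernel meets the
    row space of [V] trivially, and the dimensions add up. *)
Lemma complement_block (F : fieldType) (k l : nat) (V : 'M[F]_(k, k + l))
    (W : 'M[F]_(k + l, k)) :
  V *m W \in unitmx ->
  exists U : 'M[F]_(l, k + l),
    [/\ U *m W = 0, col_mx V U \in unitmx
      & forall p (Y : 'M[F]_(p, k + l)), Y *m W = 0 -> (Y <= U)%MS].
Proof.
move=> VWu; have rW : \rank W = k.
  apply/eqP; rewrite eqn_leq rank_leq_col /= -[X in (X <= _)%N](mxrank_unit VWu).
  exact: mxrankM_maxr.
have rU : \rank (kermx W) = l by rewrite mxrank_ker rW addKn.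
have [U defU freeU] : exists2 U : 'M_(l, k + l), (U :=: kermx W)%MS & row_free U.
  move: (row_base _) (eq_row_base (kermx W)) (row_base_free (kermx W)).
  by rewrite rU => U; exists U.
have UW : U *m W = 0 by apply/sub_kermxP; rewrite defU.
exists U; split=> // [|p Y YW]; last by rewrite defU; apply/sub_kermxP.
rewrite -row_free_unit -kermx_eq0; set X := kermx _.
have := mulmx_ker (col_mx V U); rewrite -/X -[X]hsubmxK mul_row_col => XVU.
have XV : lsubmx X = 0.
  have := congr1 (mulmx^~ W) XVU; rewrite /= mulmxDl -!mulmxA UW mulmx0 addr0 mul0mx.
  by move=> XVW; rewrite -[lsubmx X](mulmxK VWu) XVW mul0mx.
rewrite XV mul0mx add0r in XVU *.
have -> : rsubmx X = 0 by apply: (row_free_inj freeU); rewrite /= XVU mul0mx.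
by rewrite row_mx0.
Qed.

(* The blocks are listed in a sequence, and not in a function on ['I_k], so that
   prepending a block computes. *)
Definition index_le1_form (F : fieldType) (n : nat) (E A : 'M[F]_n) : Prop :=
  exists s : seq (option F * nat),
    weierstrass_form E A (fun i : 'I_(size s) => (nth (None, 0%N) s i).1)
      (fun i : 'I_(size s) => (nth (None, 0%N) s i).2)
    /\ forall b, b \in s -> b.1 = None -> (b.2 <= 1)%N.

Lemma index_le1_form_index (F : fieldType) (n : nat) (E A : 'M[F]_n) :
  index_le1_form E A -> exists2 nu, pair_index E A nu & (nu <= 1)%N.
Proof.
case=> s [Ws s_le1]; set ev := fun i : 'I__ => _ in Ws; set sz := fun i : 'I__ => _ in Ws.
exists (\max_(i | ev i == None) sz i)%N; first by exists (size s), ev, sz.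
by apply/bigmax_leqP => i /eqP ev_i; apply: s_le1 ev_i; apply: mem_nth.
Qed.

Lemma index_le1_form0 (F : fieldType) (E A : 'M[F]_0) : index_le1_form E A.
Proof.
exists [::]; split=> //; split=> [[]//|].
exists (big_ord0 _ _ _ _), 1%:M, 1%:M; split; rewrite ?unitmx1 //; by apply/matrixP => -[].
Qed.

Lemma index_le1_form_cons (F : fieldType) (n p : nat) (E A : 'M[F]_n) ev :
    (0 < p)%N -> (ev = None -> (p <= 1)%N) -> index_le1_form E A ->
  index_le1_form (block_mx (canonical_blockE ev p) 0 0 E)
                 (block_mx (canonical_blockA ev p) 0 0 A).
Proof.
move=> p_gt0 p_le1 [s [[sz_gt0 [szn [P [Q [Pu Qu defE defA]]]]] s_le1]].
subst n; rewrite !castmx_id in defE defA.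
exists ((ev, p) :: s); split; last first.
  by move=> b; rewrite inE => /predU1P[-> | /s_le1].
split=> [[[|i] lt_i] //|]; first exact: (sz_gt0 (Ordinal (lt_i : i < size s)%N)).
have szn : (\sum_(i < size ((ev, p) :: s)) (nth (None, 0) ((ev, p) :: s) i).2
            = p + \sum_(i < size s) (nth (None, 0) s i).2)%N by rewrite big_ord_recl.
exists szn, (block_mx 1%:M 0 0 P), (block_mx 1%:M 0 0 Q).
by split; first [ by rewrite unitmxE det_ublock det1 mul1r
  | rewrite mxdiag_recl castmx_comp castmx_id !mulmx_block;
    rewrite !(mulmx0, mul0mx, addr0, add0r, mul1mx, mulmx1); congr block_mx ].
Qed.

Lemma index_le1_form_equiv (F : fieldType) (n : nat) (P E A Q : 'M[F]_n) :
    P \in unitmx -> Q \in unitmx ->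
  index_le1_form (P *m E *m Q) (P *m A *m Q) -> index_le1_form E A.
Proof.
move=> Pu Qu [s [[sz_gt0 [szn [P1 [Q1 [P1u Q1u defE defA]]]]] s_le1]].
exists s; split=> //; split=> //; exists szn, (P1 *m P), (Q *m Q1).
by split; rewrite ?unitmx_mul ?P1u ?Qu // -?defE -?defA !mulmxA.
Qed.

(** Induction on the size: the row space of [V] and the left kernel of [W] are complementary and
    stable under [A], so one Jordan block splits off. All blocks are finite. *)
Lemma jordan_index_le1_form (F : closedFieldType) (n : nat) (A : 'M[F]_n) :
  index_le1_form 1%:M A.
Proof.
have [r] := ubnP n; elim: r => // r IHr in n A *; rewrite ltnS => le_nr.
have [n0 | n_gt0] := posnP n; first by subst n; apply: index_le1_form0.
have [a [k [V [W [k_gt0 VA AW VWu]]]]] := dual_jordan_chains A n_gt0.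
have [l def_n] : exists l, n = (k + l)%N.
  exists (n - k)%N; rewrite subnKC // -(mxrank_unit VWu).
  exact: leq_trans (mxrankM_maxl _ _) (rank_leq_col _).
subst n; have [U [UW VUu subU]] := complement_block VWu.
have /submxP[A' UA] : (U *m A <= U)%MS by apply: subU; rewrite -mulmxA AW mulmxA UW mul0mx.
set P := col_mx V U in VUu.
have PA : P *m A = block_mx (jordan_block a k) 0 0 A' *m P.
  by rewrite mul_col_mx mul_block_col VA UA !mul0mx addr0 add0r.
apply: (@index_le1_form_equiv _ _ P _ _ (invmx P)); rewrite ?unitmx_inv //.
rewrite mulmx1 mulmxV // PA mulmxK // scalar_mx_block.
apply: (@index_le1_form_cons _ _ _ _ _ (Some a)) => //; apply: IHr.
by apply: leq_trans le_nr; rewrite -[X in (X < _)%N]add0n ltn_add2r.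
Qed.

(** The added pair [(0, 1)] consists of [d] infinite blocks of size one, prepended one at a time. *)
Lemma index_le1_form_infinity (F : closedFieldType) (d n : nat) (E A : 'M[F]_n) :
  index_le1_form E A ->
  index_le1_form (block_mx (0 : 'M_d) 0 0 E) (block_mx (1%:M : 'M_d) 0 0 A).
Proof.
move=> EA; elim: d => [|d IHd].
  have blk0 (X : 'M_0) (Y : 'M[F]_n) : block_mx X 0 0 Y = Y.
    have rshift0 (s : 'I_n) : s = rshift 0 s by apply: val_inj.
    by apply/matrixP => s t; rewrite [in LHS](rshift0 s) [in LHS](rshift0 t) block_mxEdr.
  by rewrite !blk0.
have := @index_le1_form_cons _ _ 1 _ _ None isT (fun _ => isT) IHd.
have -> : canonical_blockE (None : option F) 1 = 0.
  by apply/matrixP => i j; rewrite !ord1 !mxE mul0rn add0r.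
have blkA (X : 'M[F]_1) (Y : 'M[F]_d) (Z : 'M[F]_n) :
    block_mx X 0 0 (block_mx Y 0 0 Z) = block_mx (block_mx X 0 0 Y) 0 0 Z.
  have := @block_mxA _ _ _ _ _ _ _ X 0 0 0 Y 0 0 0 Z.
  by rewrite /= !row_mx0 !col_mx0 castmx_id.
by rewrite !blkA block_mx0 /= -scalar_mx_block.
Qed.

(* [T] and [S] span the left and right kernels of [E]; adapted bases bring the
   pair to the form (diag(0, E2), diag(1, A2)) with [E2] invertible. *)
Lemma index_le1_form_of_kernel (F : closedFieldType) (n k : nat) (E A : 'M[F]_n)
    (T : 'M[F]_(k, n)) (S : 'M[F]_(n, k)) :
    T *m E = 0 -> E *m S = 0 -> (\rank E + k)%N = n -> T *m A *m S \in unitmx ->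
  index_le1_form E A.
Proof.
move=> TE ES rE TASu.
have [l def_n] : exists l, n = (k + l)%N by exists (\rank E); rewrite addnC.
subst n.
have TASu' : T *m (A *m S) \in unitmx by rewrite mulmxA.
(* [V] kills [A *m S] and [U^T] is killed by [T *m A], so both off-diagonal blocks of the
   transformed [A] vanish. *)
have [V [VAS TVu _]] := complement_block TASu'.
have STAu : S^T *m (T *m A)^T \in unitmx by rewrite -trmx_mul unitmx_tr.
have [U [/(congr1 trmx) UTA SUu _]] := complement_block STAu.
rewrite trmx_mul trmxK trmx0 in UTA.
set G := T *m A *m S in TASu.
pose P := block_mx (invmx G) 0 0 1%:M *m col_mx T V; pose Q := row_mx S U^T.
have Pu : P \in unitmx.
  by rewrite unitmx_mul TVu unitmxE det_ublock det1 mulr1 -unitmxE unitmx_inv TASu.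
have Qu : Q \in unitmx by rewrite -unitmx_tr tr_row_mx trmxK.
have PMQ M : P *m M *m Q =
    block_mx (invmx G *m (T *m M *m S)) (invmx G *m (T *m M *m U^T))
             (V *m M *m S) (V *m M *m U^T).
  rewrite /P mul_block_col !mul0mx mul1mx addr0 add0r mul_col_mx mul_col_row.
  by rewrite !mulmxA.
have PEQ : P *m E *m Q = block_mx 0 0 0 (V *m E *m U^T).
  by rewrite PMQ TE -(mulmxA V) ES !mul0mx !mulmx0.
have PAQ : P *m A *m Q = block_mx 1%:M 0 0 (V *m A *m U^T).
  by rewrite PMQ -(mulmxA V) UTA VAS mulVmx // mulmx0.
(* [E] has rank [l], and equivalence preserves it, so the only nonzero block has full rank. *)
have E2u : V *m E *m U^T \in unitmx.
  have := rank_diag_block_mx (0 : 'M[F]_k) (V *m E *m U^T).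
  have Qf : row_free Q by rewrite row_free_unit.
  have rPE : \rank (P *m E) = \rank E.
    have Pf : row_full P by rewrite row_full_unit.
    by rewrite (eqmxMfull E Pf).
  rewrite -PEQ (mxrankMfree _ Qf) rPE.
  rewrite mxrank0 add0n -row_free_unit /row_free => <-.
  by rewrite -(eqn_add2r k) rE addnC.
set E2 := V *m E *m U^T in PEQ E2u.
pose P2 : 'M_(k + l) := block_mx 1%:M 0 0 (invmx E2).
apply: (@index_le1_form_equiv _ _ (P2 *m P) _ _ Q) => //.
  by rewrite unitmx_mul Pu unitmxE det_ublock det1 mul1r -unitmxE unitmx_inv E2u.
rewrite -!(mulmxA P2) PEQ PAQ !mulmx_block.
rewrite !(mulmx0, mul0mx, addr0, add0r, mul1mx) mulVmx //.
exact/index_le1_form_infinity/jordan_index_le1_form.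
Qed.

(** * Full row rank at index at most one *)

Lemma mul_mxdiag (F : fieldType) (k : nat) (p : 'I_k -> nat)
    (X Y : forall i, 'M[F]_(p i)) :
  (\mxdiag_i X i) *m (\mxdiag_i Y i) = \mxdiag_i (X i *m Y i).
Proof.
rewrite /(mxdiag Y) mul_mxdiag_mxblock; apply/eq_mxblock => i j.
by case: eqVneq => [->|]; rewrite ?conform_mx_id ?mulmx0.
Qed.

(** Every infinite block is the scalar pair [(0, 1)]. Hence [DE] is the idempotent selecting the
    finite blocks, and [DA] is the identity on the infinite ones. *)
Lemma weierstrass_form_index_le1 (F : fieldType) (n k : nat) (E A : 'M[F]_n)
    (ev : 'I_k -> option F) (sz : 'I_k -> nat) :
    weierstrass_form E A ev sz -> (\max_(i | ev i == None) sz i <= 1)%N ->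
  exists P Q DE DA : 'M[F]_n,
    [/\ P \in unitmx /\ Q \in unitmx, P *m E *m Q = DE, P *m A *m Q = DA,
        DE *m (1%:M - DE) = 0 & DA *m (1%:M - DE) = 1%:M - DE].
Proof.
case=> sz_gt0 [szn [P [Q [Pu Qu defE defA]]]] /bigmax_leqP sz_le1.
subst n; rewrite !castmx_id in defE defA.
have blkE i : canonical_blockE (ev i) (sz i) = ((ev i != None)%:R)%:M.
  case ev_i: (ev i) => [a|] //=.
  have sz1 : (sz i <= 1)%N by rewrite sz_le1 ?ev_i.
  apply/matrixP => s t; rewrite !mxE mul0rn add0r.
  by rewrite gtn_eqF // ltnS (leq_trans _ (leq0n s)) // -ltnS (leq_trans (ltn_ord t)).
exists P, Q, (\mxdiag_i canonical_blockE (ev i) (sz i)),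
  (\mxdiag_i canonical_blockA (ev i) (sz i)).
rewrite -mxdiagZ -mxdiagB !mul_mxdiag; split=> //.
  rewrite -[RHS]mxdiag0; apply: eq_mxdiag => i; rewrite blkE.
  by case: (_ != _); rewrite ?subrr ?mulmx0 // raddf0 mul0mx.
apply: eq_mxdiag => i; rewrite blkE.
by case: (ev i) => [a|] /=; rewrite ?subrr ?mulmx0 // mul1mx.
Qed.

(** The columns of [Q *m (1%:M - DE)] lie in the kernel of [E], hence in the span of [S]. If [X]
    kills [E] and [A *m S], then [Y = X *m invmx P] kills both [DE] and [1%:M - DE]. *)
Lemma rank_pencil_index_le1 (F : fieldType) (n k nu : nat) (E A : 'M[F]_n)
    (S : 'M[F]_(n, k)) :
    nullspace_basis E S -> pair_index E A nu -> (nu <= 1)%N ->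
  row_free (row_mx E (A *m S)).
Proof.
move=> [_ kerE] [r [ev [sz [EA ->]]]] /(weierstrass_form_index_le1 EA).
move=> [P [Q [DE [DA [[Pu Qu] defE defA DEK DAK]]]]].
rewrite -kermx_eq0; set X := kermx _.
have := mulmx_ker (row_mx E (A *m S)); rewrite -/X mul_mx_row -row_mx0.
case/eq_row_mx => XE XAS.
have EQ0 : E *m (Q *m (1%:M - DE)) = 0.
  by rewrite -[LHS](mulKmx Pu) (mulmxA E) 2!(mulmxA P) defE DEK mulmx0.
have XAQ0 : X *m A *m (Q *m (1%:M - DE)) = 0.
  apply/matrixP => s t.
  have : E *m col t (Q *m (1%:M - DE)) = 0 by rewrite -col_mulmx EQ0 col0.
  case/kerE => y /(congr1 (mulmx (X *m A))).
  rewrite -col_mulmx => /matrixP/(_ s 0); rewrite mxE => ->.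
  by rewrite mulmxA -(mulmxA X) XAS mul0mx !mxE.
pose Y := X *m invmx P.
have defX : X = Y *m P by rewrite mulmxKV.
have YDE : Y *m DE = 0 by rewrite -defE !mulmxA -defX XE mul0mx.
have : Y *m DA *m (1%:M - DE) = 0 by rewrite -defA !mulmxA -defX -(mulmxA _ Q) XAQ0.
rewrite -mulmxA DAK mulmxBr YDE subr0 mulmx1 => Y0.
by rewrite defX Y0 mul0mx.
Qed.

(** * Positive semidefinite and dissipative matrices *)

Lemma trmxC_mul (C : numClosedFieldType) (m n p : nat) (X : 'M[C]_(m, n))
    (Y : 'M[C]_(n, p)) : (X *m Y)^t* = Y^t* *m X^t*.
Proof. by rewrite trmx_mul map_mxM. Qed.

Lemma trmxC_eq0 (C : numClosedFieldType) (m n : nat) (X : 'M[C]_(m, n)) :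
  X^t* = 0 -> X = 0.
Proof. by move=> X0; rewrite -[X]trmxCK X0 trmx0 map_mx0. Qed.

Lemma trmxC_mul_ge0 (C : numClosedFieldType) (n : nat) (x : 'cV[C]_n) :
  0 <= (x^t* *m x) 0 0.
Proof.
by rewrite mxE sumr_ge0 // => i _; rewrite !mxE mulrC mul_conjC_ge0.
Qed.

Lemma trmxC_mul_eq0 (C : numClosedFieldType) (n : nat) (x : 'cV[C]_n) :
  (x^t* *m x) 0 0 = 0 -> x = 0.
Proof.
rewrite mxE => /psumr_eq0P sum0; apply/colP => i; rewrite mxE.
have := sum0 _ i isT; rewrite !mxE mulrC => x0; apply/eqP.
by rewrite -mul_conjC_eq0 x0 // => j _; rewrite !mxE mulrC mul_conjC_ge0.
Qed.

Lemma psdmxD (C : numClosedFieldType) (n : nat) (M N : 'M[C]_n) :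
  psdmx M -> psdmx N -> psdmx (M + N).
Proof.
move=> [hM pM] [hN pN]; split; first by rewrite linearD map_mxD -hM -hN.
by move=> x; rewrite mulmxDr mulmxDl mxE addr_ge0.
Qed.

Lemma psdmx_gram (C : numClosedFieldType) (n m : nat) (B : 'M[C]_(n, m)) :
  psdmx (B *m B^t*).
Proof.
split=> [|x]; first by rewrite trmxC_mul trmxCK.
have := trmxC_mul_ge0 (B^t* *m x).
by rewrite trmxC_mul trmxCK !mulmxA.
Qed.

(* Moving from [x] in the direction [- M x] would otherwise make the quadratic
   form negative. *)
Lemma psdmx_ker (C : numClosedFieldType) (n : nat) (M : 'M[C]_n) (x : 'cV[C]_n) :
  psdmx M -> (x^t* *m M *m x) 0 0 = 0 -> M *m x = 0.
Proof.
move=> [hM pM] qx; set g := M *m x; apply: trmxC_mul_eq0.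
set a := (g^t* *m g) 0 0; have a_ge0 : 0 <= a by apply: trmxC_mul_ge0.
set c := (g^t* *m M *m g) 0 0; have c_ge0 : 0 <= c by apply: pM.
have c2_gt0 : 0 < c + 2 by rewrite ltr_wpDl.
have c1_gt0 : 0 < c + 1 by rewrite ltr_wpDl.
(* Adding [1] keeps the denominator positive; the form at [x - t *: g] then equals
   [- (t ^+ 2 * (c + 2))]. *)
pose t := a / (c + 1); have t_ge0 : 0 <= t by rewrite divr_ge0 // ltW.
have gx : g^t* = x^t* *m M by rewrite trmxC_mul -hM.
have q_t : ((x - t *: g)^t* *m M *m (x - t *: g)) 0 0 = t * t * c - t * a - t * a.
  have -> : (x - t *: g)^t* = x^t* - t *: g^t*.
    by rewrite linearB linearZ /= map_mxB map_mxZ /= (CrealP (ger0_real t_ge0)).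
  rewrite mulmxBl -scalemxAl -gx mulmxBl !mulmxBr -!scalemxAl -!scalemxAr.
  rewrite -(mulmxA _ M x) -/g; move: qx; rewrite -gx /a /c.
  by move: (g^t* *m x) (g^t* *m g) (_ *m M *m g) => X Y Z X0; rewrite !mxE X0; ring.
have a_t : a = t * (c + 1) by rewrite mulfVK // gt_eqF.
have := pM (x - t *: g); rewrite q_t a_t.
rewrite (_ : _ - _ = - (t ^+ 2 * (c + 2))); last by ring.
rewrite oppr_ge0 pmulr_lle0 // => t2_le0.
have /eqP : t ^+ 2 = 0 by apply/le_anti; rewrite t2_le0 exprn_ge0.
by rewrite sqrf_eq0 => /eqP ->; rewrite mul0r.
Qed.

Lemma psdmxD_ker (C : numClosedFieldType) (n : nat) (M N : 'M[C]_n) (x : 'cV[C]_n) :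
  psdmx M -> psdmx N -> (M + N) *m x = 0 -> M *m x = 0 /\ N *m x = 0.
Proof.
move=> pM pN MNx; have := congr1 (fun y => (x^t* *m y) 0 0) MNx.
rewrite mulmxDl mulmxDr mulmx0 !mulmxA [LHS]mxE [RHS]mxE => /eqP.
rewrite paddr_eq0 ?pM.2 ?pN.2 // => /andP[/eqP xMx /eqP xNx].
by split; apply: psdmx_ker.
Qed.

(** The form of the skew-Hermitian [J] is purely imaginary and that of [M] is real; being equal,
    both vanish. *)
Lemma dissipative_ker (C : numClosedFieldType) (n : nat) (J M : 'M[C]_n)
    (x : 'cV[C]_n) :
  J = - J^t* -> psdmx M -> (x^t* *m (J - M) *m x) 0 0 = 0 -> M *m x = 0.
Proof.
move=> hJ pM; rewrite mulmxBr mulmxBl !mxE => /eqP; rewrite subr_eq0 => /eqP eqJM.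
apply: psdmx_ker => //; have := pM.2 x; set q := (x^t* *m M *m x) 0 0 => q_ge0.
have qJ : q = (x^t* *m J *m x) 0 0 by rewrite /q mxE -eqJM mxE.
have skewJ : (x^t* *m J *m x)^t* = - (x^t* *m J *m x).
  have hJ' : J^t* = - J by rewrite [J in RHS]hJ opprK.
  by rewrite !trmxC_mul trmxCK hJ' mulNmx mulmxN mulmxA.
have : q^* = - q by have /matrixP/(_ 0 0) := skewJ; rewrite mxE [(_^T) _ _]mxE [RHS]mxE -!qJ.
rewrite (CrealP (ger0_real q_ge0)) => /eqP.
by rewrite -addr_eq0 -mulr2n mulrn_eq0 => /eqP.
Qed.

(** * Bases of the right nullspace *)

Lemma nullspace_basis_mul0 (F : fieldType) (p q k : nat) (M : 'M[F]_(p, q))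
    (S : 'M[F]_(q, k)) :
  nullspace_basis M S -> M *m S = 0.
Proof.
move=> hS; apply/matrixP => i j.
have : M *m col j S = 0 by apply/hS.2; exists (delta_mx j 0); rewrite colE.
by rewrite -col_mulmx => /matrixP/(_ i 0); rewrite !mxE.
Qed.

Lemma nullspace_basis_inj (F : fieldType) (p q k : nat) (M : 'M[F]_(p, q))
    (S : 'M[F]_(q, k)) (w : 'cV[F]_k) :
  nullspace_basis M S -> S *m w = 0 -> w = 0.
Proof.
move=> hS Sw; apply: trmx_inj; rewrite trmx0.
have freeS : row_free S^T by rewrite /row_free mxrank_tr hS.1.
by apply: (row_free_inj freeS); rewrite /= mul0mx -trmx_mul Sw trmx0.
Qed.

(** [kermx] is a left kernel, whence the transposes: [S^T] and [kermx M^T] have the same row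
    space. *)
Lemma nullspace_basis_rank (F : fieldType) (p q k : nat) (M : 'M[F]_(p, q))
    (S : 'M[F]_(q, k)) :
  nullspace_basis M S -> (\rank M + k)%N = q.
Proof.
move=> hS; have <- : \rank (kermx M^T) = k.
  rewrite -hS.1 -(mxrank_tr S); apply/eqmx_rank/andP; split.
    apply/row_subP => i.
    have : M *m (row i (kermx M^T))^T = 0.
      by apply: trmx_inj; rewrite trmx_mul trmxK -row_mul mulmx_ker row0 trmx0.
    case/hS.2 => y /(congr1 trmx); rewrite trmxK trmx_mul => ->.
    exact: submxMl.
  by apply/sub_kermxP; rewrite -trmx_mul (nullspace_basis_mul0 hS) trmx0.
by rewrite mxrank_ker mxrank_tr subnKC // rank_leq_col.
Qed.

(** * The rank criterion for regularizing output feedback *)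

Unset Implicit Arguments.

Theorem theorem7 (K : realType) (n m : nat)
    (E J R : 'M[K[i]]_n) (B : 'M[K[i]]_(n, m))
    (hE : psdmx E) (hR : psdmx R) (hJ : J = - J^t*) (hB : \rank B = m)
    (k : nat) (S : 'M[K[i]]_(n, k)) (hS : nullspace_basis E S) :
  (exists FS FH : 'M[K[i]]_m,
     [/\ FS = - FS^t*,
         FH = FH^t*,
         regular_pair E (J + B *m FS *m B^t* - (R + B *m FH *m B^t*)),
         exists2 nu : nat,
           pair_index E (J + B *m FS *m B^t* - (R + B *m FH *m B^t*)) nu
           & (nu <= 1)%N
       & psdmx (R + B *m FH *m B^t*)])
  <->
  \rank (row_mx (row_mx E ((J - R) *m S)) B) = n.
Proof.
have ES := nullspace_basis_mul0 hS.
split=> [[FS [FH [_ _ _ [nu EA nu_le1] _]]] | rank_n].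
  have freeEA := rank_pencil_index_le1 hS EA nu_le1.
  apply/eqP; rewrite -/(row_free _) -kermx_eq0; set X := kermx _.
  have := mulmx_ker (row_mx (row_mx E ((J - R) *m S)) B).
  rewrite -/X !mul_mx_row -!row_mx0 => /eq_row_mx[/eq_row_mx[XE XJS] XB].
  apply/eqP; apply: (row_free_inj freeEA).
  rewrite /= mul0mx mul_mx_row XE -row_mx0; congr row_mx.
  (* [X *m B = 0] removes both feedback terms, whatever [FS] and [FH] are. *)
  rewrite opprD addrACA mulmxDl mulmxDr XJS add0r -!(mulmxA B) -mulmxBr.
  by rewrite !mulmxA XB !mul0mx.
set R1 := R + B *m B^t*.
have pBB := psdmx_gram B.
have pR1 : psdmx R1 by apply: psdmxD.
have ker_R1 (x : 'cV_n) : R1 *m x = 0 -> R *m x = 0 /\ B^t* *m x = 0.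
  move=> /(psdmxD_ker hR pBB)[Rx BBx]; split=> //.
  by apply: trmxC_mul_eq0; rewrite trmxC_mul trmxCK -!mulmxA (mulmxA B) BBx mulmx0 mxE.
have SJS_inj (w : 'cV_k) : S^t* *m (J - R1) *m S *m w = 0 -> w = 0.
  move=> SASw; apply: (nullspace_basis_inj hS).
  have [x def_x] : exists x, x = S *m w by exists (S *m w).
  rewrite -def_x; have xA : S^t* *m ((J - R1) *m x) = 0 by rewrite def_x !mulmxA.
  have R1x : R1 *m x = 0.
    apply: (dissipative_ker hJ pR1).
    by rewrite -mulmxA {1}def_x trmxC_mul -mulmxA xA mulmx0 mxE.
  have [Rx Bx] := ker_R1 x R1x.
  have SJx : S^t* *m J *m x = 0 by move: xA; rewrite mulmxBl R1x subr0 mulmxA.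
  have free : row_free (row_mx (row_mx E ((J - R) *m S)) B) by apply/eqP.
  (* It remains to see that [x^t*] annihilates each of the three blocks. *)
  apply: trmxC_eq0; apply: (row_free_inj free); rewrite /= mul0mx !mul_mx_row.
  rewrite -!row_mx0; congr row_mx; first congr row_mx.
  - by rewrite hE.1 -trmxC_mul def_x mulmxA ES mul0mx trmx0 map_mx0.
  - apply: trmxC_eq0.
    (* The adjoint of [x^t* *m (J - R) *m S] is [S^t* *m (- J - R) *m x], which reduces to the
       vanishing [S^t* *m J *m x] because [R *m x = 0]. *)
    have hJR : (J - R)^t* = - J - R by rewrite linearB map_mxB /= -hR.1 [in RHS]hJ opprK.
    rewrite !trmxC_mul trmxCK hJR -mulmxA mulmxBl Rx subr0 mulNmx mulmxN mulmxA.
    by rewrite SJx oppr0.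
  - by apply: trmxC_eq0; rewrite trmxC_mul trmxCK Bx.
exists 0, 1%:M.
have -> : J + B *m 0 *m B^t* - (R + B *m 1%:M *m B^t*) = J - R1.
  by rewrite mulmx0 mul0mx addr0 mulmx1.
rewrite mulmx1; split=> //.
- by rewrite trmx0 map_mx0 oppr0.
- by rewrite trmx1 map_mx1.
(* At the point [1] the pencil is the opposite of [J - (E + R1)], again dissipative. A null vector
   is thus killed by [E] and by [R1]; it has the form [S *m w], and [SJS_inj] gives [w = 0]. *)
- exists 1; rewrite scale1r -unitfE -unitmxE; apply: unitmx_colker => x EAx.
  have ER1x : (E + R1) *m x = 0.
    apply: (dissipative_ker hJ (psdmxD hE pR1)).
    by rewrite [E + _]addrC opprD addrA -opprB mulmxN mulNmx -mulmxA EAx mulmx0 oppr0 mxE.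
  have [Ex _] := psdmxD_ker hE pR1 ER1x.
  have [w def_x] := (hS.2 x).1 Ex.
  rewrite def_x [w]SJS_inj ?mulmx0 // -mulmxA -def_x -mulmxA.
  by have := EAx; rewrite mulmxBl Ex sub0r => /eqP; rewrite oppr_eq0 => /eqP ->; rewrite mulmx0.
(* As [E] is Hermitian, the adjoint of [S] spans its left kernel. *)
- apply: index_le1_form_index; apply: (index_le1_form_of_kernel (T := S^t*) (S := S)) => //.
  + by rewrite hE.1 -trmxC_mul ES trmx0 map_mx0.
  + exact: nullspace_basis_rank hS.
  + exact: unitmx_colker.
Qed.
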